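(* Suppose that the minimum of $F$ over $\mathcal{W}$ is attained and the set $\mathcal{W}^*$ of minimizers is closed; that there is a constant $G<\infty$ with $\lVert \hat{\boldsymbol g}(\boldsymbol w)\rVert\le G$ for all $\boldsymbol w\in\mathcal{W}$; and that $F$ is locally polyhedral, i.e. there is a constant $L_P>0$ such that for every $\boldsymbol w\in\mathcal{W}$, $F(\boldsymbol w)-F^*\ge L_P\lVert \boldsymbol w-\boldsymbol w^*\rVert$, where $\boldsymbol w^*$ denotes the point of $\mathcal{W}^*$ closest to $\boldsymbol w$. Let $(\boldsymbol w_t)_{t\ge 0}$ be generated by the stochastic subgradient algorithm with constant step size $\alpha>0$. Then for every integer $t\ge T_P(\alpha)$ and every positive integer $T$, $$\mathbb{E}\left[F(\bar{\boldsymbol w}_t^T)\right]-F^*\le \frac{\alpha G^2}{2}+\frac{\alpha U_P}{2T},$$ where $\bar{\boldsymbol w}_t^T=\frac1T\sum_{s=t}^{t+T-1}\boldsymbol w_s$.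
   Context: Setting: $\mathcal{W}\subseteq\mathbb{R}^N$ is a closed convex set, with Euclidean norm $\lVert\cdot\rVert$ and inner product $\langle\cdot,\cdot\rangle$. $F:\mathcal{W}\to\mathbb{R}$ is continuous and convex (possibly non-smooth, not necessarily strongly convex). $F^*=\inf_{\boldsymbol w\in\mathcal{W}}F(\boldsymbol w)$ and $\mathcal{W}^*=\{\boldsymbol w\in\mathcal{W}:F(\boldsymbol w)=F^*\}$. For each $\boldsymbol w\in\mathcal{W}$, $\boldsymbol g(\boldsymbol w)$ is a subgradient: $F(\boldsymbol w')\ge F(\boldsymbol w)+\langle \boldsymbol g(\boldsymbol w),\boldsymbol w'-\boldsymbol w\rangle$ for all $\boldsymbol w'\in\mathcal{W}$. An oracle queried at $\boldsymbol w$ returns a random vector $\hat{\boldsymbol g}(\boldsymbol w)$ (unbiased stochastic subgradient) with $\mathbb{E}[\hat{\boldsymbol g}(\boldsymbol w)\mid\boldsymbol w]=\boldsymbol g(\boldsymbol w)$. Stochastic subgradient algorithm with constant step size $\alpha>0$: $\boldsymbol w_0\in\mathcal{W}$ is a constant (deterministic) vector and $\boldsymbol w_{t+1}=\Pi_{\mathcal{W}}[\boldsymbol w_t-\alpha\hat{\boldsymbol g}(\boldsymbol w_t)]$ for $t\in\{0,1,2,\dots\}$, where $\Pi_{\mathcal{W}}$ is Euclidean projection onto $\mathcal{W}$; here $\mathbb{E}[\hat{\boldsymbol g}(\boldsymbol w_t)\mid\boldsymbol w_t]=\boldsymbol g(\boldsymbol w_t)$. For each $t$, $\boldsymbol w_t^*$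 is the unique point of $\mathcal{W}^*$ closest to $\boldsymbol w_t$. Constants: $B_P=\max\left[\frac{L_P}{2},\frac{G^2}{L_P}\right]$, $r_P=\frac{3L_P}{24G^2+2L_PG}$, $\rho_P=1-\frac{3L_P^2}{4(24G^2+2L_PG)}$, $D_P=\frac{(e^{2Gr_P}-\rho_P)e^{r_PB_P}}{1-\rho_P}$, $U_P=\frac{2(D_P+1)}{r_P^2}$, and the transient time is $T_P(\alpha)=\left\lceil\frac{r_P\lVert\boldsymbol w_0-\boldsymbol w_0^*\rVert}{\alpha\log(1/\rho_P)}\right\rceil$. *)

(* Defs.v *)
From HB Require Import structures.
From mathcomp Require Import all_boot all_order all_algebra.
From mathcomp Require Import all_classical all_reals all_analysis.

Set Implicit Arguments.
Unset Strict Implicit.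
Unset Printing Implicit Defensive.

Import Order.TTheory GRing.Theory Num.Theory.
Import numFieldNormedType.Exports.

Local Open Scope classical_set_scope.
Local Open Scope ring_scope.

Definition dotp (R : realType) (N : nat) (u v : 'rV[R]_N) : R :=
  \sum_(i < N) u ord0 i * v ord0 i.

(* The library norm on ['rV[R]_N] is the sup norm; this is the Euclidean one.
   Both induce the same topology, so [closed] and [continuous] are unaffected. *)
Definition enorm (R : realType) (N : nat) (u : 'rV[R]_N) : R :=
  Num.sqrt (dotp u u).

Definition closest_point (R : realType) (N : nat) (A : set 'rV[R]_N)
    (x p : 'rV[R]_N) : Prop :=
  A p /\ forall q, A q -> enorm (x - p) <= enorm (x - q).

(* A closest point exists and is unique when [A] is nonempty, closed and convex;
   the default value [x] is returned only if there is no closest point. *)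
Definition euclidean_proj (R : realType) (N : nat) (A : set 'rV[R]_N)
    (x : 'rV[R]_N) : 'rV[R]_N :=
  xget x [set p | closest_point A x p].

Definition min_value (R : realType) (N : nat) (W : set 'rV[R]_N)
    (F : 'rV[R]_N -> R) : R :=
  inf (F @` W).

Definition minimizers (R : realType) (N : nat) (W : set 'rV[R]_N)
    (F : 'rV[R]_N -> R) : set 'rV[R]_N :=
  [set w | W w /\ F w = min_value W F].

Definition subgradient (R : realType) (N : nat) (W : set 'rV[R]_N)
    (F : 'rV[R]_N -> R) (w g : 'rV[R]_N) : Prop :=
  forall w', W w' -> F w + dotp g (w' - w) <= F w'.

Definition locally_polyhedral (R : realType) (N : nat) (W : set 'rV[R]_N)
    (F : 'rV[R]_N -> R) (L : R) : Prop :=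
  forall w, W w ->
    L * enorm (w - euclidean_proj (minimizers W F) w) <= F w - min_value W F.

(* [Z] is a version of the conditional expectation of [X] given the
   sub-sigma-algebra [G]. *)
Definition is_cond_expectation (d : measure_display)
    (Omega : measurableType d) (R : realType)
    (P : probability Omega R) (G : set (set Omega)) (X Z : Omega -> R) : Prop :=
  [/\ G `<=` measurable,
      P.-integrable setT (EFin \o X),
      P.-integrable setT (EFin \o Z),
      forall B : set R, measurable B -> G (Z @^-1` B) &
      forall A, G A -> (\int[P]_(omega in A) (X omega)%:E =
                        \int[P]_(omega in A) (Z omega)%:E)%E].

(* E[X | Y] = h(Y), coordinatewise; [g_sigma_preimage] of the coordinates of [Y]
   is the sigma-algebra generated by [Y]. *)
Definition cond_mean_eq (d : measure_display)
    (Omega : measurableType d) (R : realType)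
    (P : probability Omega R) (N : nat) (X Y : Omega -> 'rV[R]_N)
    (h : 'rV[R]_N -> 'rV[R]_N) : Prop :=
  forall i : 'I_N,
    is_cond_expectation P
      (g_sigma_preimage (fun (j : 'I_N) omega => Y omega ord0 j))
      (fun omega => X omega ord0 i) (fun omega => h (Y omega) ord0 i).

(* [ghat t w omega] is the answer of the oracle to the query [w] at time [t]. *)
Fixpoint sgd (Omega : Type) (R : realType) (N : nat) (W : set 'rV[R]_N)
    (alpha : R) (ghat : nat -> 'rV[R]_N -> Omega -> 'rV[R]_N) (w0 : 'rV[R]_N)
    (t : nat) (omega : Omega) : 'rV[R]_N :=
  if t is s.+1 then
    let w := sgd W alpha ghat w0 s omega in
    euclidean_proj W (w - alpha *: ghat s w omega)
  else w0.

Definition window_average (Omega : Type) (R : realType) (N : nat)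
    (w : nat -> Omega -> 'rV[R]_N) (t T : nat) (omega : Omega) : 'rV[R]_N :=
  T%:R^-1 *: \sum_(t <= s < t + T) w s omega.

Section constants.
Variables (R : realType) (L G : R).

(* For G = 0 the divisions by zero make [r_P], [U_P] and [T_P] equal to 0. *)
Definition B_P : R := Num.max (L / 2) (G ^+ 2 / L).
Definition r_P : R := 3 * L / (24 * G ^+ 2 + 2 * L * G).
Definition rho_P : R := 1 - 3 * L ^+ 2 / (4 * (24 * G ^+ 2 + 2 * L * G)).
Definition D_P : R :=
  (expR (2 * G * r_P) - rho_P) * expR (r_P * B_P) / (1 - rho_P).
Definition U_P : R := 2 * (D_P + 1) / r_P ^+ 2.
Definition T_P (alpha dist : R) : int :=
  Num.ceil (r_P * dist / (alpha * ln (1 / rho_P))).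

End constants.

(* Main.v *)
Require Import Defs.
From HB Require Import structures.
From mathcomp Require Import all_boot all_order all_algebra.
From mathcomp Require Import all_classical all_reals all_analysis.
From mathcomp Require Import measurable_realfun ring lra.

Set Implicit Arguments.
Unset Strict Implicit.
Unset Printing Implicit Defensive.

Import Order.TTheory GRing.Theory Num.Theory.
Import numFieldNormedType.Exports.

Local Open Scope classical_set_scope.
Local Open Scope ring_scope.

(** Let [dist t] be the Euclidean distance from the iterate [w_t] to the set of
minimizers, and [proj x] the minimizer closest to [x].

Projecting onto the convex set [W] does not increase the distance to a point
of [W], so one step satisfies
  dist (t+1)^2 <= dist t^2 - 2 alpha <w_t - proj w_t, ghat> + alpha^2 G^2
([dist_step]).  Conditioning on [w_t] replaces [ghat] by the subgradient [g w_t],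
whose inner product with [w_t - proj w_t] is at least the excess
[F w_t - min F].  Taking means, summing over the window from [t] to [t + T - 1]
and applying Jensen's inequality bounds the mean excess of the average by
  alpha G^2 / 2 + E[dist t^2] / (2 alpha T)
([mean_average_excess]).  The claim then amounts to E[dist t^2] <= alpha^2 U_P
once [t >= T_P] ([mean_sqr_dist_le]).

That second bound is a drift argument.  Write Y_t = dist t / alpha.  When
[Y_t >= B_P], the linear growth of [F] away from its minimizers makes the mean
of Y_(t+1) - Y_t at most - L / 2, and Y_t changes by at most [G] in a step, so
for the small exponent [r_P] the potential exp(r_P Y_t) contracts on average by
the factor [rho_P].  When [Y_t < B_P] the potential is bounded.  Hence
  E[exp(r Y_(t+1))] <= rho E[exp(r Y_t)] + (exp(2 G r) - rho) exp(r B),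
which iterates to E[exp(r Y_t)] <= rho^t exp(r Y_0) + D_P
([mean_potential_le]).  The transient time is the time at which
rho^t exp(r Y_0) drops below 1, and x^2 / 2 <= exp x turns the exponential
moment into the second moment.

The process is only known to be unbiased given the current iterate, not given
the whole past.  This suffices because both arguments use a single step, in
which [ghat] is paired with a function of [w_t] alone.  The one probabilistic
tool is thus that such a function can be pulled out of the conditional mean
([cond_mean_dotp]).  It requires the pairing function to be measurable for the
sigma-algebra of [w_t]; the nearest-minimizer map is, because projection onto a
convex set is nonexpansive, hence continuous.

The drift needs [L <= G].  If some point of [W] is not a minimizer this follows
from [L |x - proj x| <= F x - min F <= G |x - proj x|]; otherwise [F] is constant
on [W] and the excess vanishes. *)

(** * Euclidean geometry of row vectors *)

Lemma cvg_sumr {R : realType} {T I : Type} (F : set_system T) {FF : Filter F}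
    (s : seq I) (f : I -> T -> R) (l : I -> R) :
  (forall i, f i x @[x --> F] --> l i) ->
  \sum_(i <- s) f i x @[x --> F] --> \sum_(i <- s) l i.
Proof.
move=> fl; elim: s => [|i s IHs].
  by rewrite big_nil; under eq_fun do rewrite big_nil; exact: cvg_cst.
by rewrite big_cons; under eq_fun do rewrite big_cons; exact: cvgD.
Qed.

Section euclidean_geometry.
Context {R : realType} {N : nat}.
Implicit Types (u v w x y p q : 'rV[R]_N) (a : R).

Lemma dotpC u v : dotp u v = dotp v u.
Proof. by apply: eq_bigr => i _; rewrite mulrC. Qed.

Lemma dotpDr u v w : dotp u (v + w) = dotp u v + dotp u w.
Proof.
by rewrite /dotp -big_split; apply: eq_bigr => i _; rewrite mxE mulrDr.
Qed.

Lemma dotpZr a u v : dotp u (a *: v) = a * dotp u v.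
Proof.
by rewrite /dotp mulr_sumr; apply: eq_bigr => i _; rewrite mxE mulrCA.
Qed.

Lemma dotpNr u v : dotp u (- v) = - dotp u v.
Proof. by rewrite -scaleN1r dotpZr mulN1r. Qed.

Lemma dotpBr u v w : dotp u (v - w) = dotp u v - dotp u w.
Proof. by rewrite dotpDr dotpNr. Qed.

Lemma dotp0r u : dotp u 0 = 0.
Proof. by rewrite -(scale0r 0) dotpZr mul0r. Qed.

Lemma dotpBl u v w : dotp (v - w) u = dotp v u - dotp w u.
Proof. by rewrite dotpC dotpBr !(dotpC u). Qed.

Lemma dotpZl a u v : dotp (a *: u) v = a * dotp u v.
Proof. by rewrite dotpC dotpZr dotpC. Qed.

Lemma dotpvv_ge0 u : 0 <= dotp u u.
Proof. by apply: sumr_ge0 => i _; rewrite -expr2 sqr_ge0. Qed.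

Lemma enorm_ge0 u : 0 <= enorm u.
Proof. exact: sqrtr_ge0. Qed.

Lemma sqr_enorm u : enorm u ^+ 2 = dotp u u.
Proof. by rewrite sqr_sqrtr ?dotpvv_ge0. Qed.

Lemma sqr_enormB u v :
  enorm (u - v) ^+ 2 = enorm u ^+ 2 - 2 * dotp u v + enorm v ^+ 2.
Proof. by rewrite !sqr_enorm !(dotpBl, dotpBr) (dotpC v u); ring. Qed.

Lemma enorm_eq0 u : enorm u = 0 -> u = 0.
Proof.
move=> u0; have := sqr_enorm u; rewrite u0 expr0n /= => /esym duu0.
apply/rowP => i; rewrite mxE.
have: u ord0 i * u ord0 i = 0.
  by apply: (psumr_eq0P _ duu0) => // j _; rewrite -expr2 sqr_ge0.
by move/eqP; rewrite mulf_eq0 orbb => /eqP.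
Qed.

Lemma enorm0 : enorm (0 : 'rV[R]_N) = 0.
Proof. by rewrite /enorm dotp0r sqrtr0. Qed.

Lemma enormN u : enorm (- u) = enorm u.
Proof. by rewrite /enorm dotpNr dotpC dotpNr opprK. Qed.

Lemma dotp_le_enorm u v : dotp u v <= enorm u * enorm v.
Proof.
have [->|u0] := eqVneq u 0.
  by rewrite dotpC dotp0r mulr_ge0 ?enorm_ge0.
have [->|v0] := eqVneq v 0.
  by rewrite dotp0r mulr_ge0 ?enorm_ge0.
have ue : 0 < enorm u.
  by rewrite lt_neqAle enorm_ge0 eq_sym (contra_neq (@enorm_eq0 u)).
have ve : 0 < enorm v.
  by rewrite lt_neqAle enorm_ge0 eq_sym (contra_neq (@enorm_eq0 v)).
(* The square |b u - a v|^2 with a = |u|, b = |v| equals 2ab(ab - <u, v>). *)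
have := sqr_ge0 (enorm (enorm v *: u - enorm u *: v)).
rewrite sqr_enormB !sqr_enorm !(dotpZl, dotpZr) -!sqr_enorm.
set a := enorm u; set b := enorm v; set c := dotp u v => h.
have {h} : 0 <= (2 * (a * b)) * (a * b - c).
  by move: h; rewrite (_ : _ + _ = (2 * (a * b)) * (a * b - c)) //; ring.
by rewrite pmulr_rge0 ?subr_ge0// !mulr_gt0.
Qed.

Lemma normr_dotp_le u v : `|dotp u v| <= enorm u * enorm v.
Proof.
by rewrite ler_norml dotp_le_enorm lerNl -dotpNr -(enormN v) dotp_le_enorm.
Qed.

Lemma coord_le_enorm u i : `|u ord0 i| <= enorm u.
Proof.
rewrite -sqrtr_sqr ler_sqrt ?dotpvv_ge0// /dotp (bigD1 i)//= -expr2 lerDl.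
by apply: sumr_ge0 => j _; rewrite -expr2 sqr_ge0.
Qed.

Lemma le_enorm_sqr u a : 0 <= a -> enorm u ^+ 2 <= a ^+ 2 -> enorm u <= a.
Proof. by move=> a0; rewrite ler_pXn2r ?nnegrE ?enorm_ge0. Qed.

Lemma continuous_dotpBB x : continuous (fun q => dotp (x - q) (x - q)).
Proof.
move=> q; rewrite /dotp; apply: (@cvg_sumr _ _ _ (nbhs q) (nbhs_filter q)) => i.
have xi : {for q, continuous (fun q' => (x - q') ord0 i)}.
  rewrite (_ : (fun _ => _) = (fun q' => x ord0 i - q' ord0 i)).
    by apply: continuousB; [exact: cst_continuous|exact: coord_continuous].
  by apply/funext => q'; rewrite !mxE.
exact: continuousM.
Qed.

Lemma continuous_enormB x : continuous (fun q => enorm (x - q)).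
Proof.
move=> q.
apply: (@continuous_comp _ _ _ (fun q' => dotp (x - q') (x - q')) Num.sqrt).
  exact: continuous_dotpBB.
exact: sqrt_continuous.
Qed.

End euclidean_geometry.

(** * Projection onto a closed convex set *)

Section projection.
Context {R : realType} {N : nat} (A : set 'rV[R]_N).
Hypotheses (A_neq0 : A !=set0) (A_closed : closed A) (A_convex : convex_set A).
Implicit Types (x y p q : 'rV[R]_N).
Local Notation proj := (euclidean_proj A).

(** Only the part of [A] at least as close to [x] as some fixed point of [A]
matters, and that part is compact. *)
Lemma exists_closest_point x : exists p, closest_point A x p.
Proof.
have [q0 Aq0] := A_neq0.
pose f q := dotp (x - q) (x - q).
pose K := A `&` [set q | f q <= f q0].
have K_closed : closed K.
  apply: closedI => //; rewrite (_ : [set _ | _] = f @^-1` [set a | a <= f q0])//.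
  by apply: closed_comp; [move=> q _; exact: continuous_dotpBB|exact: closed_le].
have K_bounded : bounded_set K.
  exists (enorm x + enorm (x - q0)); split; first by rewrite num_real.
  move=> M hM q [_ fq] /=.
  have M0 : 0 <= M by apply: le_trans _ (ltW hM); rewrite addr_ge0 ?enorm_ge0.
  have qM j : `|q ord0 j| <= M.
    apply: le_trans _ (ltW hM).
    have -> : q ord0 j = x ord0 j - (x - q) ord0 j by rewrite !mxE; ring.
    apply: le_trans (ler_normB _ _) _; apply: lerD.
      by rewrite coord_le_enorm.
    by apply: le_trans (coord_le_enorm _ _) _; rewrite ler_sqrt ?dotpvv_ge0.
  rewrite [leLHS]/Num.norm/= mx_normrE; apply/bigmax_leP; split => // -[i j] _ /=.
  by rewrite (ord1 i); exact: qM.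
have K_compact := bounded_closed_compact K_bounded K_closed.
have [||p pK pmin] := @EVT_min_rV R N f K _ K_compact.
- by exists q0; split => /=.
- exact/continuous_subspaceT/continuous_dotpBB.
- move: pK; rewrite inE => -[Ap fp]; exists p; split => // q Aq.
  rewrite ler_sqrt ?dotpvv_ge0//.
  have [fq|/ltW fq] := leP (f q) (f q0); first by apply: pmin; rewrite inE.
  exact: le_trans fp fq.
Qed.

Lemma proj_closest x : closest_point A x (proj x).
Proof. by have [p xp] := exists_closest_point x; apply: (xgetI _ xp). Qed.

Lemma proj_in x : A (proj x).
Proof. by have [] := proj_closest x. Qed.

(** Moving from [proj x] towards [q] inside [A] cannot bring one closer to [x],
so the derivative of the squared distance in that direction is nonnegative. *)
Lemma proj_obtuse x q : A q -> dotp (x - proj x) (q - proj x) <= 0.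
Proof.
move=> Aq; have [Ap pmin] := proj_closest x; set p := proj x in Ap pmin *.
set c := dotp _ _; set n := enorm (q - p) ^+ 2.
have n0 : 0 <= n by exact: sqr_ge0.
rewrite leNgt; apply/negP => c0.
have cn0 : 0 < c + n by rewrite ltr_wpDr.
(* A step length small enough that the first-order gain 2lc exceeds the
   second-order loss l^2 n. *)
pose l := c / (c + n).
have l0 : 0 < l by rewrite divr_gt0.
have l1 : l <= 1 by rewrite ler_pdivrMr// mul1r lerDl.
have Apl : A (p + l *: (q - p)).
  have := A_convex (Itv01 (ltW l0) l1) (mem_set Aq) (mem_set Ap).
  rewrite inE; congr A.
  change (l *: q + (1 - l) *: p = p + l *: (q - p)).
  by rewrite scalerBl scale1r scalerBr addrCA.
have := pmin _ Apl; rewrite -(@ler_pXn2r _ 2)// ?nnegrE ?enorm_ge0//.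
rewrite opprD addrA [leRHS]sqr_enormB dotpZr -/c [enorm (l *: _) ^+ 2]sqr_enorm.
rewrite dotpZl dotpZr -[dotp (q - p) _]sqr_enorm -/n.
have ln : l * (c + n) = c by rewrite divfK// gt_eqF.
nra.
Qed.

Lemma enorm_proj_le x q : A q -> enorm (proj x - q) <= enorm (x - q).
Proof.
move=> Aq; apply: le_enorm_sqr; first exact: enorm_ge0.
have -> : x - q = (x - proj x) - (q - proj x).
  by rewrite opprB addrA subrK.
rewrite -enormN opprB sqr_enormB.
have := proj_obtuse x Aq; have := sqr_ge0 (enorm (x - proj x)); lra.
Qed.

(** With p, q the projections of x, y, the two obtuse-angle inequalities say
that x - y = (p - q) - e for some e with <p - q, e> <= 0. *)
Lemma proj_nonexpansive x y : enorm (proj x - proj y) <= enorm (x - y).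
Proof.
set p := proj x; set q := proj y.
have h1 := proj_obtuse x (proj_in y); have h2 := proj_obtuse y (proj_in x).
rewrite -/p -/q in h1 h2.
have xy : x - y = (p - q) - ((y - q) - (x - p)).
  by apply/rowP => i; rewrite !mxE; ring.
apply: le_enorm_sqr; first exact: enorm_ge0.
rewrite xy [leRHS]sqr_enormB; move: h1 h2.
have -> : dotp (p - q) (y - q - (x - p)) =
    dotp (y - q) (p - q) + dotp (x - p) (q - p).
  by rewrite dotpBr (dotpC (p - q)) (dotpC _ (x - p)) -[q - p]opprB dotpNr.
have := sqr_ge0 (enorm (y - q - (x - p))); lra.
Qed.

Lemma continuous_proj_coord i : continuous (fun x => proj x ord0 i).
Proof.
move=> x; apply/(@cvgrPdist_le _ _ _ (nbhs x) (nbhs_filter x)) => /= e e0.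
have := @continuous_enormB R N x x; rewrite /continuous_at subrr enorm0.
move=> /(@cvgrPdist_le _ _ _ (nbhs x) (nbhs_filter x)) /(_ _ e0).
apply: filterS => y.
rewrite sub0r normrN ger0_norm ?enorm_ge0//; apply: le_trans.
have -> : proj x ord0 i - proj y ord0 i = (proj x - proj y) ord0 i.
  by rewrite !mxE.
exact: le_trans (coord_le_enorm _ _) (proj_nonexpansive _ _).
Qed.

End projection.

(** * Measurability of functions of random vectors *)

Section vector_measurability.
Context {R : realType} {N : nat} {d : measure_display} {T : measurableType d}.
Implicit Types (X Y : T -> 'rV[R]_N) (W : set 'rV[R]_N).

Definition vector_measurable Y :=
  forall i : 'I_N, measurable_fun setT (fun t => Y t ord0 i).

(** An open set is a countable union of boxes with rational centres and radii
of the form 1/(k+1), and the preimage of a box only involves the coordinates. *)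
Lemma open_preimage_measurable Y (U : set 'rV[R]_N) :
  vector_measurable Y -> open U -> measurable (Y @^-1` U).
Proof.
move=> mY oU.
pose box (qk : 'rV[rat]_N * nat) : set 'rV[R]_N :=
  [set x | forall i, `|x ord0 i - ratr (qk.1 ord0 i)| < (qk.2.+1%:R)^-1].
have mbox qk : measurable (Y @^-1` box qk).
  rewrite (_ : _ @^-1` _ = \bigcap_(i in [set: 'I_N])
    [set t | `|Y t ord0 i - ratr (qk.1 ord0 i)| < (qk.2.+1%:R)^-1]); last first.
    by apply/seteqP; split => t /= h i; [move=> _; exact: h|exact: h].
  apply: fin_bigcap_measurable => // i _.
  have mi : measurable_fun setT (fun t => `|Y t ord0 i - ratr (qk.1 ord0 i)|).
    by apply: measurableT_comp => //; apply: measurable_funB.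
  rewrite -[X in measurable X]setTI (_ : [set t | _] =
    (fun t => `|Y t ord0 i - ratr (qk.1 ord0 i)|) @^-1` `]-oo, (qk.2.+1%:R)^-1[).
    exact: mi.
  by apply/seteqP; split => t /=; rewrite in_itv.
rewrite (_ : _ @^-1` _ = \bigcup_qk
    (if asbool (box qk `<=` U) then Y @^-1` box qk else set0)); last first.
  apply/seteqP; split => [t /= Ut|t [qk _]]; last first.
    by case: asboolP => // qkU /= /qkU.
  have : nbhs (Y t) U by exact: open_nbhs_nbhs.
  move=> /nbhs_ballP[e /= e0 eU].
  have [k ke] : exists k : nat, (k.+1%:R)^-1 < e / 2.
    have e2 : 0 < e / 2 by rewrite divr_gt0.
    have [k _ /(_ k (leqnn _)) hk] := near_infty_natSinv_lt (PosNum e2).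
    by exists k.
  have kke : (k.+1%:R)^-1 + (k.+1%:R)^-1 < e by rewrite [ltRHS]splitr ltrD.
  have k0 : 0 < (k.+1%:R)^-1 :> R by rewrite invr_gt0.
  have qP i : exists q : rat, `|Y t ord0 i - ratr q| < (k.+1%:R)^-1.
    have : Y t ord0 i - (k.+1%:R)^-1 < Y t ord0 i + (k.+1%:R)^-1.
      by rewrite ltrD2l gt0_cp.
    move=> /rat_in_itvoo[q]; rewrite in_itv/= => /andP[q1 q2].
    by exists q; rewrite distrC ltr_distl q1 q2.
  pose q := \row_i xchoose (qP i) : 'rV[rat]_N.
  exists (q, k) => //; case: asboolP => [_ i|[]]/=.
    by rewrite mxE; exact: (xchooseP (qP i)).
  move=> y yq; apply: eU; split => // j i; rewrite (ord1 j).
  have := yq i; have /= := xchooseP (qP i); rewrite mxE.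
  set z := ratr _ => h1 h2; rewrite /ball/=.
  have -> : Y t ord0 i - y ord0 i = (Y t ord0 i - z) - (y ord0 i - z) by ring.
  by apply: le_lt_trans (ler_normB _ _) _; exact: lt_trans (ltrD h1 h2) kke.
apply: countable_bigcupT_measurable => [|qk]; first exact: countableP.
by case: asboolP => // _; exact: mbox.
Qed.

Lemma within_continuous_measurable W (f : 'rV[R]_N -> R) Y :
  {within W, continuous f} -> vector_measurable Y -> (forall t, W (Y t)) ->
  measurable_fun setT (f \o Y).
Proof.
move=> /continuousP cf mY WY; apply: (measurability _ (RGenOpens.measurableE R)).
move=> _ [_ [a [b ->] <-]]; rewrite setTI comp_preimage.
have : open (f @^-1` `]a, b[ : set (subspace W)).
  by apply: cf; exact: interval_open.
move=> /open_subspaceP[V oV VW].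
rewrite (_ : _ @^-1` _ = Y @^-1` V); first exact: open_preimage_measurable.
apply/seteqP; split => t /= ht.
  have : (f @^-1` `]a, b[ `&` W) (Y t) by [].
  by rewrite -VW => -[].
have : (V `&` W) (Y t) by [].
by rewrite VW => -[].
Qed.

Lemma measurable_dotp X Y : vector_measurable X -> vector_measurable Y ->
  measurable_fun setT (fun t => dotp (X t) (Y t)).
Proof. by move=> mX mY; apply: measurable_sum => i; exact: measurable_funM. Qed.

Lemma measurable_enorm Y :
  vector_measurable Y -> measurable_fun setT (fun t => enorm (Y t)).
Proof.
move=> mY; apply: measurableT_comp; last exact: measurable_dotp.
by apply: continuous_measurable_fun; exact: sqrt_continuous.
Qed.

Lemma vector_measurableB X Y : vector_measurable X -> vector_measurable Y ->
  vector_measurable (fun t => X t - Y t).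
Proof.
move=> mX mY i; under eq_fun do rewrite !mxE.
exact: measurable_funB.
Qed.

Lemma vector_measurable_proj (A : set 'rV[R]_N) Y :
  A !=set0 -> closed A -> convex_set A -> vector_measurable Y ->
  vector_measurable (fun t => euclidean_proj A (Y t)).
Proof.
move=> A0 cA vA mY i.
pose f x := euclidean_proj A x ord0 i.
apply: (@within_continuous_measurable setT f) => //.
exact/continuous_subspaceT/continuous_proj_coord.
Qed.

End vector_measurability.

(** * Means of bounded random variables *)

Section bounded_random_variables.
Context {R : realType} {d : measure_display} {T : measurableType d}.
Variable P : probability T R.
Implicit Types (X Y : T -> R) (c M : R).

(** Every random variable below is bounded, and this class is closed under the
ring operations, so it replaces all integrability conditions. *)
Definition bounded_rv X :=
  measurable_fun setT X /\ exists M, forall t, `|X t| <= M.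

Lemma bounded_rv_cst c : bounded_rv (cst c).
Proof. by split; [exact: measurable_cst|exists `|c|]. Qed.

Lemma bounded_rvD X Y :
  bounded_rv X -> bounded_rv Y -> bounded_rv (fun t => X t + Y t).
Proof.
move=> [mX [M XM]] [mY [M' YM]]; split; first exact: measurable_funD.
by exists (M + M') => t; rewrite (le_trans (ler_normD _ _))// lerD.
Qed.

Lemma bounded_rvM X Y :
  bounded_rv X -> bounded_rv Y -> bounded_rv (fun t => X t * Y t).
Proof.
move=> [mX [M XM]] [mY [M' YM]]; split; first exact: measurable_funM.
by exists (M * M') => t; rewrite normrM ler_pM.
Qed.

Lemma bounded_rvZ c X : bounded_rv X -> bounded_rv (fun t => c * X t).
Proof. by move=> bX; apply: bounded_rvM => //; exact: bounded_rv_cst. Qed.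

Lemma bounded_rvB X Y :
  bounded_rv X -> bounded_rv Y -> bounded_rv (fun t => X t - Y t).
Proof.
move=> bX bY; under eq_fun do rewrite -mulN1r.
by apply: bounded_rvD => //; exact: bounded_rvZ.
Qed.

Lemma bounded_rv_sum I (s : seq I) (X : I -> T -> R) :
  (forall i, bounded_rv (X i)) -> bounded_rv (fun t => \sum_(i <- s) X i t).
Proof.
move=> bX; elim: s => [|i s IHs].
  by under eq_fun do rewrite big_nil; exact: bounded_rv_cst.
by under eq_fun do rewrite big_cons; exact: bounded_rvD.
Qed.

Lemma bounded_rv_indic (A : set T) : measurable A -> bounded_rv (\1_A : T -> R).
Proof.
move=> mA; split; first exact: measurable_indic.
by exists 1 => t; rewrite indicE; case: (_ \in _); rewrite ?normr1 ?normr0.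
Qed.

Lemma bounded_rv_integrable X :
  bounded_rv X -> P.-integrable setT (EFin \o X).
Proof.
move=> [mX [M XM]]; apply: measurable_bounded_integrable => //.
  by rewrite (le_lt_trans (probability_le1 P _)) ?ltry.
exists M; split; first by rewrite num_real.
by move=> M' MM' t _ /=; rewrite (le_trans (XM t))// ltW.
Qed.

Lemma ler_mean X Y : bounded_rv X -> bounded_rv Y -> (forall t, X t <= Y t) ->
  \int[P]_t X t <= \int[P]_t Y t.
Proof.
by move=> bX bY XY; apply: le_Rintegral => //; exact: bounded_rv_integrable.
Qed.

Lemma meanD X Y : bounded_rv X -> bounded_rv Y ->
  \int[P]_t (X t + Y t) = \int[P]_t X t + \int[P]_t Y t.
Proof. by move=> bX bY; apply: RintegralD => //; exact: bounded_rv_integrable. Qed.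

Lemma meanB X Y : bounded_rv X -> bounded_rv Y ->
  \int[P]_t (X t - Y t) = \int[P]_t X t - \int[P]_t Y t.
Proof. by move=> bX bY; apply: RintegralB => //; exact: bounded_rv_integrable. Qed.

Lemma meanZ c X : bounded_rv X -> \int[P]_t (c * X t) = c * \int[P]_t X t.
Proof. by move=> bX; apply: RintegralZl => //; exact: bounded_rv_integrable. Qed.

Lemma mean_cst c : \int[P]_t c = c.
Proof. by rewrite Rintegral_cst// [X in fine X](probability_setT P) mulr1. Qed.

Lemma mean_sum I (s : seq I) (X : I -> T -> R) :
  (forall i, bounded_rv (X i)) ->
  \int[P]_t (\sum_(i <- s) X i t) = \sum_(i <- s) \int[P]_t X i t.
Proof.
move=> bX; elim: s => [|i s IHs].
  by rewrite big_nil; under eq_Rintegral do rewrite big_nil; exact: mean_cst.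
rewrite big_cons -IHs -meanD//; last exact: bounded_rv_sum.
by under eq_Rintegral do rewrite big_cons.
Qed.

End bounded_random_variables.

(** * Pulling known factors out of a conditional mean *)

Section conditional_mean.
Context {R : realType} {d : measure_display} {T : measurableType d}.
Variable P : probability T R.

(** The sum is the integer part of [y], written through the level sets of [y]
so that it becomes a combination of indicators. *)
Lemma staircase (n : nat) (y : R) : 0 <= y -> y <= n%:R ->
  `|y - \sum_(k < n) (k.+1%:R <= y)%R%:R| <= 1.
Proof.
move=> y0 yn; pose s m : R := \sum_(k < m) (k.+1%:R <= y)%R%:R.
have sS m : s m.+1 = s m + (m.+1%:R <= y)%R%:R by rewrite /s big_ord_recr.
have s_le m : s m <= Num.min y m%:R.
  elim: m => [|m]; first by rewrite /s big_ord0 le_min y0 lexx.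
  rewrite sS !le_min => /andP[sy sm].
  have [my|_] := leP (m.+1%:R) y; rewrite ?addr0.
    have h : s m + 1 <= m.+1%:R by rewrite -natr1 lerD2r.
    by rewrite h (le_trans h my).
  by rewrite sy (le_trans sm)// ler_nat.
have s_ge m : Num.min y m%:R <= s m + 1.
  elim: m => [|m]; first by rewrite /s big_ord0 ge_min add0r ler01 orbT.
  rewrite sS.
  have [my|ym] := leP (m%:R) y.
    have -> : s m = m%:R.
      rewrite /s (eq_bigr (fun=> 1)) ?sumr_const ?card_ord// => k _.
      by rewrite (le_trans _ my)// ler_nat.
    by move=> _; rewrite ge_min -natr1 lerD2r lerDl ler0n orbT.
  by move=> yz; rewrite ge_min (le_trans yz)// lerD2r lerDl ler0n.
have := s_le n; have := s_ge n; rewrite -/(s n) min_l//.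
by move=> h1 h2; rewrite ler_norml; apply/andP; split; lra.
Qed.

(** For each n, n (h + M) is within 1 of a finite sum of indicators of level
sets of [h], against which [V] integrates to 0.  Hence n |E[h V]| <= sup |V| for
every n, which forces E[h V] = 0. *)
Lemma mean_mul_level_sets_eq0 (V h : T -> R) :
  bounded_rv V -> bounded_rv h ->
  (forall c, \int[P]_t (V t * \1_[set u | c <= h u] t) = 0) ->
  \int[P]_t (h t * V t) = 0.
Proof.
move=> bV bh V0.
have [mh [M hM]] := bh; have [mV [C VC]] := bV.
have mlev c : measurable [set u | c <= h u].
  rewrite -[X in measurable X]setTI (_ : [set u | _] = h @^-1` `[c, +oo[).
    exact: mh.
  by apply/seteqP; split => t /=; rewrite in_itv/= andbT.
(* The level set at - M is the whole space. *)
have EV : \int[P]_t V t = 0.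
  rewrite -(V0 (- M)); apply: eq_Rintegral => t _.
  rewrite indicE mem_set ?mulr1//=.
  by have := hM t; rewrite ler_norml => /andP[].
have key n : n.+1%:R * `|\int[P]_t (h t * V t)| <= C.
  pose y t := n.+1%:R * (h t + M).
  have M0 : 0 <= M by rewrite (le_trans _ (hM point)).
  have [K yK] : exists K : nat, forall t, y t <= K%:R.
    exists (Num.bound (n.+1%:R * (M + M))) => t.
    have: y t <= n.+1%:R * (M + M).
      by rewrite ler_wpM2l// lerD2r (le_trans (ler_norm _)).
    by move=> /le_trans; apply; rewrite ltW// archi_boundP// mulr_ge0// addr_ge0.
  have y0 t : 0 <= y t.
    rewrite mulr_ge0// -lerBlDr sub0r.
    by have := hM t; rewrite ler_norml => /andP[].
  have by_ : bounded_rv y.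
    by apply: bounded_rvZ; apply: bounded_rvD => //; exact: bounded_rv_cst.
  pose A (k : 'I_K) := [set u | k.+1%:R / n.+1%:R - M <= h u].
  have sE t : \sum_(k < K) (k.+1%:R <= y t)%R%:R = \sum_(k < K) \1_(A k) t :> R.
    apply: eq_bigr => k _; rewrite indicE; congr (nat_of_bool _)%:R.
    rewrite /A; apply/idP/idP => [yt|/set_mem/=].
      by apply/mem_set; rewrite /= lerBlDr ler_pdivrMr// mulrC.
    by rewrite lerBlDr ler_pdivrMr// mulrC.
  have bs : bounded_rv (fun t => \sum_(k < K) \1_(A k) t : R).
    by apply: bounded_rv_sum => k; apply: bounded_rv_indic; exact: mlev.
  have EVs : \int[P]_t (V t * (\sum_(k < K) \1_(A k) t)) = 0.
    under eq_Rintegral do rewrite mulr_sumr.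
    rewrite mean_sum => [|k]; first by rewrite big1// => k _; exact: V0.
    by apply: bounded_rvM => //; apply: bounded_rv_indic; exact: mlev.
  have bV1 := bounded_rvM bV (bounded_rvB by_ bs).
  have hVE : n.+1%:R * \int[P]_t (h t * V t) =
      \int[P]_t (V t * (y t - \sum_(k < K) \1_(A k) t)).
    under [RHS]eq_Rintegral do rewrite mulrBr.
    rewrite meanB ?EVs ?subr0; try exact: bounded_rvM.
    have -> : \int[P]_t (V t * y t) =
        \int[P]_t (n.+1%:R * (h t * V t) + n.+1%:R * M * V t).
      by apply: eq_Rintegral => t _; rewrite /y; ring.
    rewrite meanD ?meanZ ?EV ?mulr0 ?addr0//; try exact: bounded_rvM.
      by apply: bounded_rvZ; exact: bounded_rvM.
    exact: bounded_rvZ.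
  rewrite -[n.+1%:R]ger0_norm// -normrM hVE.
  apply: le_trans (le_normr_Rintegral _ _) _ => //.
    exact: bounded_rv_integrable.
  rewrite -[leRHS](mean_cst P); apply: ler_mean.
  - split; first by apply: measurableT_comp => //; case: bV1.
    by have [_ [B hB]] := bV1; exists B => t; rewrite normr_id.
  - exact: bounded_rv_cst.
  - move=> t; rewrite normrM -[leRHS]mulr1 ler_pM//.
    by rewrite -sE; exact: staircase.
apply/eqP; rewrite -normr_eq0 eq_le normr_ge0 andbT leNgt; apply/negP => E0.
set e := `|_| in key E0.
have := key (Num.bound (C / e)); apply/negP; rewrite -ltNge -ltr_pdivrMr//.
have C0 : 0 <= C by rewrite (le_trans _ (VC point)).
by rewrite (lt_le_trans (archi_boundP _)) ?divr_ge0 ?(ltW E0)// ler_nat.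
Qed.

Lemma cond_expectation_pullout (S : set (set T)) (X Z h : T -> R) :
  is_cond_expectation P S X Z -> bounded_rv X -> bounded_rv Z -> bounded_rv h ->
  (forall c, S [set t | c <= h t]) ->
  \int[P]_t (h t * X t) = \int[P]_t (h t * Z t).
Proof.
move=> [mS _ _ _ XZ] bX bZ bh Sh; apply/eqP; rewrite -subr_eq0.
rewrite -meanB; try exact: bounded_rvM.
under eq_Rintegral do rewrite -mulrBr.
apply/eqP; apply: mean_mul_level_sets_eq0 => //; first exact: bounded_rvB.
move=> c; set A := [set u | _]; have SA : S A by exact: Sh.
have bA : bounded_rv (\1_A : T -> R) by apply: bounded_rv_indic; exact: mS.
under eq_Rintegral do rewrite mulrBl.
rewrite meanB; try exact: bounded_rvM.
have restrictE f : \int[P]_t (f t * \1_A t) = \int[P]_(t in A) f t.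
  by rewrite [RHS]Rintegral_mkcond; apply: eq_Rintegral => t _; rewrite patch_indic.
by rewrite !restrictE /Rintegral XZ// subrr.
Qed.

(** The sample space with the sigma-algebra of [Y].  Making it a type of its own
lets [measurable_fun] speak of measurability with respect to [Y]. *)
Definition sigma_of {N : nat} (Y : T -> 'rV[R]_N) :=
  g_sigma_algebraType (\big[setU/set0]_(i < N)
    preimage_set_system setT (fun t => Y t ord0 i) measurable).

Lemma vector_measurable_sigma_of {N : nat} (Y : T -> 'rV[R]_N) :
  vector_measurable (Y : sigma_of Y -> 'rV[R]_N).
Proof.
move=> i _ B mB; apply: sub_gen_smallest.
rewrite (bigD1 i)//=; left.
by exists B.
Qed.

(** The unbiasedness of an oracle in usable form: paired with any bounded
function [H] of the query [Y], its answer may be replaced by its conditional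
mean.  Giving [H] the domain [sigma_of Y] makes [vector_measurable H] say that
[H] is a function of [Y]. *)
Lemma cond_mean_dotp {N : nat} (X Y : T -> 'rV[R]_N) (g : 'rV[R]_N -> 'rV[R]_N)
    (H : sigma_of Y -> 'rV[R]_N) :
  cond_mean_eq P X Y g ->
  (forall i, bounded_rv (fun t => X t ord0 i)) ->
  (forall i, bounded_rv (fun t => g (Y t) ord0 i)) ->
  vector_measurable H -> (exists M, forall t i, `|H t ord0 i| <= M) ->
  \int[P]_t dotp (H t) (X t) = \int[P]_t dotp (H t) (g (Y t)).
Proof.
move=> XYg bX bg mH [M HM].
have levH i c : g_sigma_preimage (fun j t => Y t ord0 j) [set t | c <= H t ord0 i].
  have := mH i measurableT _ (measurable_itv `[c, +oo[).
  rewrite setTI; congr (g_sigma_preimage _ _).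
  by apply/seteqP; split => t /=; rewrite in_itv/= andbT.
have bH i : @bounded_rv R d T (fun t => H t ord0 i).
  split; last by exists M => t.
  have [mS _ _ _ _] := XYg i.
  by move=> _ B mB; apply: mS; exact: mH.
rewrite /dotp !mean_sum; try by move=> i; exact: bounded_rvM.
apply: eq_bigr => i _; exact: (cond_expectation_pullout (XYg i)).
Qed.

End conditional_mean.

(** * Exponential drift of the scaled distance *)

Section exponential_bounds.
Context {R : realType}.
Implicit Types x : R.

(** Squaring exp(x/2) <= 1 / (1 - x/2) leaves a polynomial inequality:
(1 + x + x^2) (1 - x/2)^2 - 1 = x^2 (1 - 3x + x^2) / 4. *)
Lemma expR_le_quadratic x : x <= 1 / 3 -> expR x <= 1 + x + x ^+ 2.
Proof.
move=> x3; have h : 1 - x / 2 <= expR (- (x / 2)) by exact: expR_ge1Dx.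
have p : 0 < 1 - x / 2 by lra.
have e2 : expR x = expR (x / 2) ^+ 2 by rewrite -expRM_natl; congr expR; field.
have hi : expR (x / 2) <= (1 - x / 2)^-1.
  by rewrite -[expR _]invrK -expRN lef_pV2 // posrE expR_gt0.
have : expR x <= (1 - x / 2)^-1 ^+ 2.
  by rewrite e2 ler_pXn2r // nnegrE ?expR_ge0 // invr_ge0 ltW.
move/le_trans; apply; rewrite exprVn invf_ple ?posrE ?exprn_gt0//; last first.
  by have := sqr_ge0 (x + 1 / 2); lra.
rewrite -[leLHS]mul1r ler_pdivrMr; last first.
  by have := sqr_ge0 (x + 1 / 2); lra.
have q : 0 <= 1 - 3 * x + x ^+ 2 by have := sqr_ge0 x; lra.
have := mulr_ge0 (sqr_ge0 x) q; rewrite -subr_ge0 => hh.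
rewrite -subr_ge0 (_ : _ - _ = x ^+ 2 * (1 - 3 * x + x ^+ 2) / 4); last by field.
lra.
Qed.

(** From exp x >= (1 + x/4)^4; the square of 1 + x/2 would be too small for
large x. *)
Lemma sqr_half_le_expR x : 0 <= x -> x ^+ 2 / 2 <= expR x.
Proof.
move=> x0; have h : 1 + x / 4 <= expR (x / 4) by exact: expR_ge1Dx.
have e4 : expR x = expR (x / 4) ^+ 4 by rewrite -expRM_natl; congr expR; field.
have : (1 + x / 4) ^+ 4 <= expR x.
  by rewrite e4 ler_pXn2r // nnegrE ?expR_ge0 //; lra.
apply: le_trans.
rewrite -subr_ge0 (_ : _ - _ =
    1 + x * ((x / 4 - 1 / 4) ^+ 2 + 15 / 16) + x ^+ 4 / 256); last by field.
have := sqr_ge0 (x / 4 - 1 / 4); have := exprn_ge0 4 x0; nra.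
Qed.

End exponential_bounds.

Lemma U_P_ge0 {R : realType} (L G : R) : 0 < L -> 0 <= G -> 0 <= U_P L G.
Proof.
move=> L0 G0; have den0 : 0 <= 24 * G ^+ 2 + 2 * L * G.
  by have := sqr_ge0 G; have := mulr_ge0 (ltW L0) G0; lra.
have r0 : 0 <= r_P L G by apply: divr_ge0 => //; rewrite mulr_ge0// ltW.
have rho1 : 0 <= 1 - rho_P L G.
  rewrite /rho_P opprB addrC subrK; apply: divr_ge0; rewrite mulr_ge0//.
  exact: sqr_ge0.
have e1 : 1 <= expR (2 * G * r_P L G).
  apply: le_trans (expR_ge1Dx _); rewrite lerDl; apply: mulr_ge0 => //.
  exact: mulr_ge0.
have D0 : 0 <= D_P L G.
  apply: divr_ge0 => //; apply: mulr_ge0; last exact: expR_ge0.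
  by lra.
by apply: divr_ge0; [apply: mulr_ge0 => //; exact: addr_ge0|exact: sqr_ge0].
Qed.

Section drift.
Context {R : realType} (L G alpha : R).
Hypotheses (L_gt0 : 0 < L) (LG : L <= G) (alpha_gt0 : 0 < alpha).
Local Notation r := (r_P L G).
Local Notation rho := (rho_P L G).
Local Notation B := (B_P L G).
Local Notation K := ((expR (2 * G * r) - rho) * expR (r * B)).

Let G_gt0 : 0 < G. Proof. exact: lt_le_trans LG. Qed.

Let denom_gt0 : 0 < 24 * G ^+ 2 + 2 * L * G.
Proof. by rewrite addr_gt0 ?mulr_gt0 ?exprn_gt0. Qed.

Lemma r_P_gt0 : 0 < r.
Proof. by rewrite divr_gt0// mulr_gt0. Qed.

Lemma r_PE : r * (24 * G ^+ 2 + 2 * L * G) = 3 * L.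
Proof. by rewrite /r_P divfK// gt_eqF. Qed.

(** Makes the second-order term r^2 G^2 of the drift at most a quarter of the
first-order term r L / 2, so that a contraction by at least
r L / 4 = 1 - rho_P remains. *)
Lemma r_P_sqr_le : r * G ^+ 2 <= L / 8.
Proof.
have := r_PE; have := mulr_gt0 (mulr_gt0 r_P_gt0 L_gt0) G_gt0; nra.
Qed.

Lemma r_P_le : r * G <= 1 / 8.
Proof.
rewrite -(ler_pM2r G_gt0) -mulrA -expr2; apply: le_trans r_P_sqr_le _; move: LG; lra.
Qed.

Lemma rho_PE : rho = 1 - r * L / 4.
Proof. by rewrite /rho_P /r_P; field; rewrite gt_eqF. Qed.

Lemma rho_P_lt1 : rho < 1.
Proof. by rewrite rho_PE; have := mulr_gt0 r_P_gt0 L_gt0; lra. Qed.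

Lemma rho_P_gt0 : 0 < rho.
Proof.
have rLG : r * L <= r * G by rewrite ler_wpM2l// ltW// r_P_gt0.
by rewrite rho_PE; have := r_P_le; lra.
Qed.

Lemma B_P_ge : G <= B.
Proof.
rewrite /B_P le_max; apply/orP; right; rewrite ler_pdivlMr// expr2.
by rewrite ler_wpM2l// ltW.
Qed.

Lemma B_P_mul_ge : G ^+ 2 <= B * L.
Proof. by rewrite -ler_pdivrMr// /B_P le_max lexx orbT. Qed.

Let aB_gt0 : 0 < alpha * B.
Proof. by rewrite mulr_gt0// (lt_le_trans G_gt0 B_P_ge). Qed.

Let expR_growth_ge1 : 1 <= expR (2 * G * r).
Proof.
apply: le_trans (expR_ge1Dx _); rewrite lerDl; apply: mulr_ge0.
  by rewrite mulr_ge0// ltW.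
exact: ltW r_P_gt0.
Qed.

Lemma drift_const_ge0 : 0 <= K.
Proof.
by rewrite mulr_ge0 ?expR_ge0// subr_ge0 (le_trans (ltW rho_P_lt1)).
Qed.

(** The coefficient of the noise in the one-step bound of the potential
exp(r x / alpha), where x is the distance: far from the minimizers it comes from
expanding exp(r (L / 2 - s / x)) to second order, and close to them the noise is
bounded crudely and gets weight 0.  The maximum equals x on the branch where it
occurs; it makes the denominator continuous and bounded away from 0. *)
Definition drift_weight (x : R) : R :=
  if alpha * B <= x
  then expR (r * x / alpha) * (r + r ^+ 2 * L) / Num.max x (alpha * B) else 0.

Lemma drift_weight_ge0 x : 0 <= drift_weight x.
Proof.
rewrite /drift_weight; case: ifPn => // _.
rewrite divr_ge0 ?le_max ?(ltW aB_gt0) ?orbT// mulr_ge0 ?expR_ge0// addr_ge0//.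
  exact: ltW r_P_gt0.
by rewrite mulr_ge0 ?sqr_ge0// ltW.
Qed.

Lemma drift_weight_le x M : x <= M -> drift_weight x <=
  expR (r * M / alpha) * (r + r ^+ 2 * L) / (alpha * B).
Proof.
move=> xM; have rr : 0 <= r + r ^+ 2 * L.
  apply: addr_ge0; first exact: ltW r_P_gt0.
  by rewrite mulr_ge0 ?sqr_ge0// ltW.
rewrite /drift_weight; case: ifPn => [far|_].
  apply: ler_pM; rewrite ?invr_ge0 ?le_max ?(ltW aB_gt0) ?orbT ?mulr_ge0 ?expR_ge0//.
    rewrite ler_wpM2r// ler_expR ler_wpM2r ?invr_ge0 ?(ltW alpha_gt0)//.
    by rewrite ler_wpM2l ?(ltW r_P_gt0).
  by rewrite lef_pV2 ?posrE ?lt_max ?aB_gt0 ?orbT// le_max lexx orbT.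
by rewrite divr_ge0 ?(ltW aB_gt0)// mulr_ge0 ?expR_ge0.
Qed.

Lemma measurable_drift_weight : measurable_fun setT drift_weight.
Proof.
apply: measurable_fun_ifT => //; first exact: measurable_fun_ler.
apply: measurable_funM.
  apply: measurable_funM => //; apply: measurableT_comp => //.
  by apply: measurable_funM => //; exact: measurable_funM.
have cmax x : {for x, continuous (id \max cst (alpha * B) : R -> R)}.
  apply: (@continuous_max R R id (cst (alpha * B))); first exact: cvg_id.
  exact: cvg_cst.
apply: continuous_measurable_fun => x.
apply: (@continuousV R R (id \max cst (alpha * B))); last exact: cmax.
by rewrite gt_eqF//= lt_max aB_gt0 orbT.
Qed.

(** One step of the potential, pathwise.  Here x and x' are the distances before
and after the step and s is the inner product of the displacement from the
nearest minimizer with the noisy subgradient.  The mean of s given the iterate is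
at least L x, so after taking means the weighted term is nonnegative and can be
dropped; keeping it is what makes the inequality valid without any mean. *)
Lemma exponential_drift (x x' s : R) : 0 <= x -> 0 <= x' -> `|s| <= G * x ->
  x' ^+ 2 <= x ^+ 2 - 2 * alpha * s + alpha ^+ 2 * G ^+ 2 ->
  expR (r * x' / alpha) + drift_weight x * (s - L * x) <=
    rho * expR (r * x / alpha) + K.
Proof.
move=> x0 x'0; rewrite ler_norml => /andP[s1 s2] xx'.
have r0 := r_P_gt0; have a0 := alpha_gt0.
rewrite /drift_weight; case: ifPn => [far|]; last first.
  rewrite -ltNge => near; rewrite mul0r addr0.
  have x'x : x' <= x + alpha * G.
    rewrite -(@ler_pXn2r _ 2)// ?nnegrE ?addr_ge0 ?mulr_ge0 ?(ltW G_gt0)//.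
      by nra.
    exact: ltW.
  have : expR (r * x' / alpha) <= expR (2 * G * r) * expR (r * x / alpha).
    rewrite -expRD ler_expR.
    have -> : 2 * G * r + r * x / alpha = r * (x + alpha * (2 * G)) / alpha.
      by field; rewrite gt_eqF.
    rewrite ler_wpM2r ?invr_ge0 ?(ltW a0)// ler_wpM2l ?(ltW r0)//.
    by have := mulr_gt0 a0 G_gt0; lra.
  move=> /le_trans; apply.
  suff : (expR (2 * G * r) - rho) * expR (r * x / alpha) <= K by lra.
  rewrite ler_wpM2l//.
    by rewrite subr_ge0 (le_trans (ltW rho_P_lt1)).
  rewrite ler_expR -mulrA ler_wpM2l ?(ltW r0)// ler_pdivrMr// mulrC; exact: ltW.
have x_gt0 : 0 < x by exact: lt_le_trans far.
rewrite max_l//.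
(* From here on the iterate is far: completing the square gives
   x' <= x + alpha (L / 2 - u). *)
pose u := s / x; have su : s = u * x by rewrite /u divfK// gt_eqF.
have u1 : - G <= u by rewrite /u ler_pdivlMr// mulNr.
have u2 : u <= G by rewrite /u ler_pdivrMr.
pose y := L / 2 - u.
have L0 := L_gt0; have LG' := LG.
have x'x : x' <= x + alpha * y.
  have xaG : alpha * G <= x.
    by apply: le_trans far; rewrite ler_wpM2l ?B_P_ge// ltW.
  have xL : alpha * G ^+ 2 <= x * L.
    apply: le_trans (_ : alpha * B * L <= _); last by rewrite ler_wpM2r// ltW.
    by rewrite -mulrA ler_wpM2l ?B_P_mul_ge// ltW.
  have ay : - (alpha * G) <= alpha * y.
    by rewrite -mulrN ler_wpM2l ?(ltW a0)// /y; lra.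
  rewrite -(@ler_pXn2r _ 2)// ?nnegrE//; last lra.
  apply: le_trans xx' _.
  have := sqr_ge0 (alpha * y); have := ler_wpM2l (ltW a0) xL.
  by rewrite su /y; nra.
have e1 : expR (r * x' / alpha) <= expR (r * x / alpha) * expR (r * y).
  rewrite -expRD ler_expR.
  have -> : r * x / alpha + r * y = r * (x + alpha * y) / alpha.
    by field; rewrite gt_eqF.
  by rewrite ler_wpM2r ?invr_ge0 ?(ltW a0)// ler_wpM2l ?(ltW r0).
have rG := r_P_le; have rG2 := r_P_sqr_le.
have e2 : expR (r * y) <= 1 + r * y + (r * y) ^+ 2.
  apply: expR_le_quadratic.
  have : r * y <= r * (3 / 2 * G) by rewrite ler_wpM2l ?(ltW r0)// /y; lra.
  lra.
set e := expR (r * x / alpha) in e1 *.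
have e0 : 0 <= e by exact: expR_ge0.
have -> : e * (r + r ^+ 2 * L) / x * (s - L * x) =
    e * ((r + r ^+ 2 * L) * (u - L)).
  by rewrite su; field; rewrite gt_eqF.
rewrite -[leLHS]addr0; apply: lerD; last exact: drift_const_ge0.
have -> : rho * e = e * rho by rewrite mulrC.
apply: (@le_trans _ _ (e * (1 + r * y + (r * y) ^+ 2 + (r + r ^+ 2 * L) * (u - L)))).
  by rewrite [leRHS]mulrDr lerD2r (le_trans e1)// ler_wpM2l.
rewrite ler_wpM2l// rho_PE.
have uG : u ^+ 2 <= G ^+ 2.
  by rewrite -subr_ge0 subr_sqr mulr_ge0 //; lra.
have ru : r ^+ 2 * u ^+ 2 <= r * (L / 8).
  rewrite expr2 -mulrA ler_wpM2l ?(ltW r0)//; apply: le_trans rG2.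
  by rewrite ler_wpM2l ?(ltW r0).
(* The weight r + r^2 L cancels exactly the terms linear in u. *)
have -> : 1 + r * y + (r * y) ^+ 2 + (r + r ^+ 2 * L) * (u - L) =
    1 - r * L / 2 - 3 / 4 * (r * L) ^+ 2 + r ^+ 2 * u ^+ 2.
  by rewrite /y; field.
have := sqr_ge0 (r * L); have := mulr_gt0 r0 L0; lra.
Qed.

(** The transient time is the time that the factor rho^t takes to absorb the
initial potential. *)
Lemma transient_le1 (t : nat) (dist : R) :
  T_P L G alpha dist <= t%:Z -> rho ^+ t * expR (r * dist / alpha) <= 1.
Proof.
rewrite /T_P ceil_le_int -[_%:~R]/(t%:R : R).
have lrho : 0 < ln (1 / rho).
  by rewrite ln_gt0// ltr_pdivlMr ?rho_P_gt0// mul1r rho_P_lt1.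
rewrite ler_pdivrMr ?mulr_gt0// mulrCA => h.
have {}h : r * dist / alpha <= t%:R * ln (1 / rho).
  by rewrite ler_pdivrMr// [leRHS]mulrC.
have -> : rho ^+ t = expR (- (t%:R * ln (1 / rho))).
  rewrite div1r lnV ?posrE ?rho_P_gt0// mulrN opprK expRM_natl lnK//.
  by rewrite posrE rho_P_gt0.
by rewrite -expRD -[leRHS]expR0 ler_expR; lra.
Qed.

End drift.

(** * Convex sets and minimizers *)

Section convexity.
Context {R : realType} {N : nat} (W : set 'rV[R]_N).
Implicit Types (F : 'rV[R]_N -> R) (x y : 'rV[R]_N).

Lemma convex_set_comb x y (l : R) : convex_set W -> W x -> W y ->
  0 <= l -> l <= 1 -> W (l *: x + (1 - l) *: y).
Proof.
move=> cW Wx Wy l0 l1.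
by have := cW _ _ (Itv01 l0 l1) (mem_set Wx) (mem_set Wy); rewrite inE.
Qed.

Lemma convex_set_average (x : nat -> 'rV[R]_N) (t T : nat) :
  convex_set W -> (forall s, W (x s)) -> (0 < T)%N ->
  W (T%:R^-1 *: \sum_(t <= s < t + T) x s).
Proof.
move=> cW Wx; case: T => // T _; elim: T => [|T IHT].
  by rewrite addn1 big_nat1 invr1 scale1r.
rewrite addnS big_nat_recr ?leq_addr//=.
pose l : R := T.+1%:R / T.+2%:R.
have l0 : 0 <= l by rewrite divr_ge0.
have l1 : l <= 1 by rewrite ler_pdivrMr// mul1r ler_nat.
have := convex_set_comb cW IHT (Wx (t + T.+1)%N) l0 l1; congr W.
rewrite scalerDr scalerA /l; congr (_ *: _ + _ *: _).
  by rewrite mulrAC divff ?mul1r// pnatr_eq0.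
have n0 : T.+2%:R != 0 :> R by rewrite pnatr_eq0.
apply: (mulIf n0); rewrite mulVf// mulrBl mul1r divfK// -[T.+2%:R]natr1.
by rewrite addrAC subrr add0r.
Qed.

Lemma min_valueE F x : W x -> (forall y, W y -> F x <= F y) ->
  min_value W F = F x.
Proof.
move=> Wx Fx; apply/eqP; rewrite eq_le; apply/andP; split.
  by apply: ge_inf; [exists (F x) => _ [y Wy <-]; exact: Fx|exists x].
by apply: lb_le_inf; [exists (F x), x|move=> _ [y Wy <-]; exact: Fx].
Qed.

(** At a convex combination z of two minimizers x and y, the subgradient
inequalities towards x and y combine to F z <= min F. *)
Lemma minimizers_convex F (g : 'rV[R]_N -> 'rV[R]_N) : convex_set W ->
  (forall x, W x -> subgradient W F x (g x)) ->
  (forall x, W x -> min_value W F <= F x) ->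
  convex_set (minimizers W F).
Proof.
move=> cW gF Fmin; apply/convex_setW => x y; rewrite !inE.
move=> -[Wx Fx] [Wy Fy] k k0 k1.
set l := k%:num in k0 k1.
apply/mem_set; change (minimizers W F (l *: x + (1 - l) *: y)); set z := _ + _.
have Wz : W z by apply: convex_set_comb => //; exact: ltW.
split => //; apply/eqP; rewrite eq_le Fmin// andbT.
have := gF z Wz x Wx; have := gF z Wz y Wy; rewrite Fx Fy.
have -> : x - z = (1 - l) *: (x - y) by apply/rowP => i; rewrite !mxE; ring.
have -> : y - z = - l *: (x - y) by apply/rowP => i; rewrite !mxE; ring.
rewrite !dotpZr; set c := dotp _ _ => h1 h2; nra.
Qed.

(** Jensen's inequality, by averaging the subgradient inequalities at the mean
point z: the displacements x_s - z sum to 0. *)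
Lemma subgradient_average_le F (v : 'rV[R]_N) (x : nat -> 'rV[R]_N) (t T : nat) :
  (forall s, W (x s)) -> (0 < T)%N ->
  let z := T%:R^-1 *: \sum_(t <= s < t + T) x s in
  subgradient W F z v ->
  F z <= T%:R^-1 * \sum_(t <= s < t + T) F (x s).
Proof.
move=> Wx T0 z vz; have TR : 0 < T%:R :> R by rewrite ltr0n.
rewrite ler_pdivlMl//.
have : \sum_(t <= s < t + T) (F z + dotp v (x s - z)) <=
       \sum_(t <= s < t + T) F (x s) by apply: ler_sum => s _; exact: vz.
apply: le_trans; rewrite big_split/= sumr_const_nat addKn -[F z *+ T]mulr_natl lerDl.
have -> : \sum_(t <= s < t + T) dotp v (x s - z) =
    dotp v (\sum_(t <= s < t + T) x s - T%:R *: z).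
  rewrite dotpBr dotpZr; under eq_bigr do rewrite dotpBr.
  rewrite sumrB sumr_const_nat addKn -[dotp v z *+ T]mulr_natl; congr (_ - _).
  by apply/esym; apply: (big_morph (dotp v)); [exact: dotpDr|exact: dotp0r].
by rewrite /z scalerA divff ?gt_eqF// scale1r subrr dotp0r.
Qed.

End convexity.

Lemma sum_le_of_decrease {R : realType} (D e : nat -> R) (a b : R) (t T : nat) :
  (forall s, 0 <= D s) -> (forall s, D s.+1 <= D s - a * e s + b) ->
  a * \sum_(t <= s < t + T) e s <= D t + T%:R * b.
Proof.
move=> D_ge0 step.
suff : a * \sum_(t <= s < t + T) e s + D (t + T)%N <= D t + T%:R * b.
  by apply: le_trans; rewrite lerDl.
elim: T => [|T IHT]; first by rewrite addn0 big_geq// mulr0 mul0r add0r addr0.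
rewrite addnS big_nat_recr ?leq_addr//= -natr1.
by have := step (t + T)%N; lra.
Qed.

(** * The stochastic subgradient iterates *)

Section stochastic_subgradient.
Context {R : realType} {N : nat} (W : set 'rV[R]_N) (F : 'rV[R]_N -> R)
  (g : 'rV[R]_N -> 'rV[R]_N) {d : measure_display} {Omega : measurableType d}
  (P : probability Omega R) (ghat : nat -> 'rV[R]_N -> Omega -> 'rV[R]_N)
  (w0 : 'rV[R]_N) (alpha G L : R).
Hypotheses (W_closed : closed W) (W_convex : convex_set W)
  (F_continuous : {within W, continuous F})
  (g_subgradient : forall w, W w -> subgradient W F w (g w))
  (w0_in : W w0) (alpha_gt0 : 0 < alpha)
  (ghat_unbiased : forall t w, W w -> cond_mean_eq P (ghat t w) (cst w) g)
  (ghat_unbiased_iterates : forall t,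
     let w_t := sgd W alpha ghat w0 t in
     cond_mean_eq P (fun omega => ghat t (w_t omega) omega) w_t g)
  (min_attained : exists2 w, W w & forall w', W w' -> F w <= F w')
  (minimizers_closed : closed (minimizers W F))
  (ghat_bounded : forall t w omega, W w -> enorm (ghat t w omega) <= G)
  (L_gt0 : 0 < L) (F_polyhedral : locally_polyhedral W F L).

Local Notation Fmin := (min_value W F).
Local Notation proj := (euclidean_proj (minimizers W F)).
Local Notation w := (sgd W alpha ghat w0).
Local Notation gap x := (x - proj x).
Local Notation dist t omega := (enorm (gap (w t omega))).
Local Notation noisy t omega := (ghat t (w t omega) omega).

Let Fmin_le x : W x -> Fmin <= F x.
Proof. by have [y Wy Fy] := min_attained => Wx; rewrite (min_valueE Wy)// Fy. Qed.

Let minimizers_neq0 : minimizers W F !=set0.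
Proof.
by have [y Wy Fy] := min_attained; exists y; rewrite /minimizers/= (min_valueE Wy).
Qed.

Let minimizers_cvx : convex_set (minimizers W F).
Proof. exact: (@minimizers_convex _ _ _ _ g). Qed.

Let proj_min x : minimizers W F (proj x).
Proof. exact: proj_in. Qed.

Let W_neq0 : W !=set0. Proof. by exists w0. Qed.

Lemma sgd_in t omega : W (w t omega).
Proof. by case: t => // t; exact: proj_in. Qed.

Let G_ge0 : 0 <= G.
Proof. exact: le_trans (enorm_ge0 _) (ghat_bounded 0%N point w0_in). Qed.

Lemma cond_mean_bounded (X Y : Omega -> 'rV[R]_N) h i :
  cond_mean_eq P X Y h -> (forall omega, enorm (X omega) <= G) ->
  bounded_rv (fun omega => X omega ord0 i).
Proof.
move=> XY XG; have [_ /integrableP[mX _] _ _ _] := XY i.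
split; first exact/measurable_EFinP.
by exists G => omega; exact: le_trans (coord_le_enorm _ _) (XG omega).
Qed.

(** The bound on the answers of the oracle passes to their mean, by pairing them
with the constant vector [v]. *)
Lemma dotp_subgradient_le x v : W x -> dotp v (g x) <= enorm v * G.
Proof.
move=> Wx; have XY := ghat_unbiased 0%N Wx.
have bX i := cond_mean_bounded i XY (fun omega => ghat_bounded 0%N omega Wx).
rewrite -(mean_cst P (dotp v (g x))).
rewrite -(@cond_mean_dotp _ _ _ P _ _ (cst x) g (cst v) XY bX).
- rewrite -(mean_cst P (enorm v * G)); apply: ler_mean => //.
  + apply: bounded_rv_sum => i; apply: bounded_rvM => //.
    exact: (bounded_rv_cst (v ord0 i)).
  + exact: bounded_rv_cst.
  + move=> omega; apply: le_trans (dotp_le_enorm _ _) _.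
    by rewrite ler_wpM2l ?enorm_ge0// ghat_bounded.
- by move=> i; exact: (bounded_rv_cst (g x ord0 i)).
- by move=> i; exact: (measurable_cst (v ord0 i)).
- by exists (enorm v) => omega i; exact: coord_le_enorm.
Qed.

Lemma enorm_subgradient_le x : W x -> enorm (g x) <= G.
Proof.
move=> Wx; have := dotp_subgradient_le (g x) Wx; rewrite -sqr_enorm expr2.
have [->//|g0] := eqVneq (enorm (g x)) 0.
by rewrite ler_pM2l// lt_neqAle eq_sym g0 enorm_ge0.
Qed.

Lemma gap_subgradient_ge x : W x -> F x - Fmin <= dotp (gap x) (g x).
Proof.
move=> Wx; have [Wp Fp] := proj_min x.
have := g_subgradient Wx Wp; rewrite Fp -(opprB x) dotpNr dotpC; lra.
Qed.

(** [F] grows at rate at least [L] and at most [G] between a point and its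
nearest minimizer. *)
Lemma lipschitz_ge_polyhedral x : W x -> ~ minimizers W F x -> L <= G.
Proof.
move=> Wx nAx; have d0 : 0 < enorm (gap x).
  rewrite lt_neqAle enorm_ge0 andbT eq_sym; apply/eqP => /enorm_eq0/eqP.
  by rewrite subr_eq0 => /eqP xp; apply: nAx; rewrite xp; exact: proj_min.
rewrite -(ler_pM2r d0) (le_trans (F_polyhedral Wx))//.
by rewrite (le_trans (gap_subgradient_ge Wx))// mulrC dotp_subgradient_le.
Qed.

Lemma vector_measurable_sgd t : vector_measurable (w t).
Proof.
move=> i _ B mB; have [mS _ _ _ _] := ghat_unbiased_iterates t i.
by apply: mS; exact: (@vector_measurable_sigma_of _ _ _ _ (w t) i measurableT _ mB).
Qed.

Lemma vector_measurable_gap {d'} {T : measurableType d'} (Y : T -> 'rV[R]_N) :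
  vector_measurable Y -> vector_measurable (fun omega => gap (Y omega)).
Proof.
by move=> mY; apply: vector_measurableB => //; exact: vector_measurable_proj.
Qed.

(** The minimizer nearest to the old iterate bounds the new distance from above,
and projecting onto [W] does not move away from it. *)
Lemma dist_step t omega : dist t.+1 omega ^+ 2 <=
  dist t omega ^+ 2 - 2 * alpha * dotp (gap (w t omega)) (noisy t omega) +
  alpha ^+ 2 * G ^+ 2.
Proof.
set x := w t omega; set v := noisy t omega; set y := w t.+1 omega.
have [Wp _] := proj_min x.
have yp : enorm (gap y) <= enorm (gap x - alpha *: v).
  have [_ ycl] := proj_closest minimizers_neq0 minimizers_closed y.
  apply: le_trans (ycl _ (proj_min x)) _.
  rewrite [leRHS](_ : _ = enorm (x - alpha *: v - proj x)).
    exact: enorm_proj_le.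
  by congr enorm; rewrite addrAC.
apply: (@le_trans _ _ (enorm (gap x - alpha *: v) ^+ 2)).
  by rewrite ler_pXn2r// nnegrE enorm_ge0.
rewrite [leLHS]sqr_enormB dotpZr mulrA lerD2l [enorm (alpha *: v) ^+ 2]sqr_enorm.
rewrite dotpZl dotpZr -sqr_enorm mulrA -expr2 ler_wpM2l ?sqr_ge0//.
by rewrite ler_pXn2r ?nnegrE ?enorm_ge0// ghat_bounded//; exact: sgd_in.
Qed.

Lemma gap_noisy_le t omega :
  `|dotp (gap (w t omega)) (noisy t omega)| <= G * dist t omega.
Proof.
apply: le_trans (normr_dotp_le _ _) _.
by rewrite mulrC ler_wpM2r ?enorm_ge0// ghat_bounded//; exact: sgd_in.
Qed.

Lemma dist_bounded t : exists M, forall omega, dist t omega <= M.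
Proof.
elim: t => [|t [M IHt]]; first by exists (enorm (gap w0)).
exists (M + alpha * G) => omega; apply: (@le_trans _ _ (dist t omega + alpha * G)).
  apply: le_enorm_sqr; first by rewrite addr_ge0 ?enorm_ge0 ?mulr_ge0// ltW.
  apply: le_trans (dist_step t omega) _.
  have := gap_noisy_le t omega; rewrite ler_norml => /andP[+ _].
  have := alpha_gt0; set z := dotp _ _; set x := enorm _; nra.
by rewrite lerD2r.
Qed.

Lemma bounded_dist t : bounded_rv (fun omega => dist t omega).
Proof.
split; first exact/measurable_enorm/vector_measurable_gap/vector_measurable_sgd.
by have [M hM] := dist_bounded t; exists M => omega; rewrite ger0_norm ?enorm_ge0.
Qed.

Lemma bounded_noisy t i : bounded_rv (fun omega => noisy t omega ord0 i).
Proof.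
apply: cond_mean_bounded (ghat_unbiased_iterates t) _ => omega.
by rewrite ghat_bounded//; exact: sgd_in.
Qed.

Lemma bounded_gap t i : bounded_rv (fun omega => gap (w t omega) ord0 i).
Proof.
split; first exact/vector_measurable_gap/vector_measurable_sgd.
have [M hM] := dist_bounded t; exists M => omega.
exact: le_trans (coord_le_enorm _ _) (hM omega).
Qed.

Lemma bounded_mean_subgradient t i : bounded_rv (fun omega => g (w t omega) ord0 i).
Proof.
have [_ _ /integrableP[mg _] _ _] := ghat_unbiased_iterates t i.
split; first exact/measurable_EFinP.
exists G => omega; apply: le_trans (coord_le_enorm _ _) _.
exact/enorm_subgradient_le/sgd_in.
Qed.

Lemma bounded_gap_noisy t :
  bounded_rv (fun omega => dotp (gap (w t omega)) (noisy t omega)).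
Proof.
apply: bounded_rv_sum => i.
by apply: bounded_rvM; [exact: bounded_gap|exact: bounded_noisy].
Qed.

Lemma bounded_gap_subgradient t :
  bounded_rv (fun omega => dotp (gap (w t omega)) (g (w t omega))).
Proof.
apply: bounded_rv_sum => i.
by apply: bounded_rvM; [exact: bounded_gap|exact: bounded_mean_subgradient].
Qed.

Lemma bounded_excess t : bounded_rv (fun omega => F (w t omega) - Fmin).
Proof.
split.
  apply: measurable_funB => //.
  exact: within_continuous_measurable F_continuous (vector_measurable_sgd t)
    (sgd_in t).
have [M hM] := dist_bounded t; exists (M * G) => omega.
have Wx := sgd_in t omega.
rewrite ger0_norm ?subr_ge0 ?Fmin_le//.
apply: le_trans (gap_subgradient_ge Wx) _.
by apply: le_trans (dotp_subgradient_le _ Wx) _; rewrite ler_wpM2r.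
Qed.

(** The displacement from the nearest minimizer, scaled by any function of the
distance, depends on [w_t] alone, so the noise averages out against it. *)
Lemma mean_weighted_gap t (phi : R -> R) :
  measurable_fun setT phi -> (exists M, forall omega, `|phi (dist t omega)| <= M) ->
  \int[P]_omega (phi (dist t omega) * dotp (gap (w t omega)) (noisy t omega)) =
  \int[P]_omega (phi (dist t omega) * dotp (gap (w t omega)) (g (w t omega))).
Proof.
move=> mphi [M phiM].
under eq_Rintegral do rewrite -dotpZl.
under [RHS]eq_Rintegral do rewrite -dotpZl.
pose H (omega : sigma_of (w t)) := phi (dist t omega) *: gap (w t omega).
apply: (@cond_mean_dotp _ _ _ P N _ (w t) g H).
- exact: ghat_unbiased_iterates.
- exact: bounded_noisy.
- exact: bounded_mean_subgradient.
- have mgap := vector_measurable_gap (@vector_measurable_sigma_of _ _ _ _ (w t)).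
  move=> i; rewrite (_ : (fun _ => _) =
      fun omega : sigma_of (w t) =>
        phi (dist t omega) * gap (w t omega) ord0 i); last first.
    by apply/funext => omega; rewrite /H mxE.
  apply: measurable_funM; last exact: mgap.
  exact/(measurableT_comp mphi)/measurable_enorm.
- have [M' hM'] := dist_bounded t; exists (M * M') => omega i.
  rewrite mxE normrM ler_pM// (le_trans (coord_le_enorm _ _))//.
Qed.

Lemma mean_sqr_dist_step t :
  \int[P]_omega (dist t.+1 omega ^+ 2) <=
  \int[P]_omega (dist t omega ^+ 2) -
  2 * alpha * \int[P]_omega (F (w t omega) - Fmin) + alpha ^+ 2 * G ^+ 2.
Proof.
have bd2 s : bounded_rv (fun omega => dist s omega ^+ 2).
  by under eq_fun do rewrite expr2; apply: bounded_rvM; exact: bounded_dist.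
have bgn := bounded_gap_noisy t; have bgs := bounded_gap_subgradient t.
have bl : bounded_rv (fun omega => dist t omega ^+ 2 -
    2 * alpha * dotp (gap (w t omega)) (noisy t omega)).
  by apply: bounded_rvB => //; exact: bounded_rvZ.
have bc := bounded_rv_cst (T := Omega) (alpha ^+ 2 * G ^+ 2).
have := ler_mean P (bd2 t.+1) (bounded_rvD bl bc) (dist_step t).
rewrite (meanD P bl bc) mean_cst (meanB P (bd2 t) (bounded_rvZ _ bgn)).
rewrite (meanZ P _ bgn) => /le_trans; apply.
rewrite lerD2r lerB// ler_wpM2l ?mulr_ge0 ?(ltW alpha_gt0)//.
have := @mean_weighted_gap t (cst 1) (measurable_cst _) (ex_intro _ 1 _).
rewrite /=; under eq_Rintegral do rewrite mul1r.
under [X in _ -> _ = X]eq_Rintegral do rewrite mul1r.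
move=> -> => [|omega]; last by rewrite normr1.
apply: ler_mean => //; first exact: bounded_excess.
by move=> omega; apply: gap_subgradient_ge; exact: sgd_in.
Qed.

Lemma mean_excess_window t T :
  2 * alpha * \sum_(t <= s < t + T) \int[P]_omega (F (w s omega) - Fmin) <=
  \int[P]_omega (dist t omega ^+ 2) + T%:R * (alpha ^+ 2 * G ^+ 2).
Proof.
apply: (@sum_le_of_decrease R (fun s => \int[P]_omega (dist s omega ^+ 2))
  (fun s => \int[P]_omega (F (w s omega) - Fmin))); last exact: mean_sqr_dist_step.
by move=> s; apply: Rintegral_ge0 => omega _; exact: sqr_ge0.
Qed.

(** The excess at the average is bounded pointwise by the average excess,
whose mean telescopes. *)
Lemma mean_average_excess t T : (0 < T)%N ->
  ('E_P[F \o window_average w t T] - Fmin%:E <=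
   (alpha * G ^+ 2 / 2 +
    \int[P]_omega (dist t omega ^+ 2) / (2 * alpha * T%:R))%:E)%E.
Proof.
move=> T0; have TR : 0 < T%:R :> R by rewrite ltr0n.
pose z := window_average w t T.
have Wz omega : W (z omega).
  by apply: (convex_set_average t W_convex (sgd_in^~ omega) T0).
have z_le omega : F (z omega) - Fmin <=
    T%:R^-1 * \sum_(t <= s < t + T) (F (w s omega) - Fmin).
  rewrite sumrB sumr_const_nat addKn mulrBr -[Fmin *+ T]mulr_natl.
  rewrite mulrA mulVf ?gt_eqF// mul1r lerD2r.
  apply: (subgradient_average_le (v := g (z omega)) (W := W)) => //.
    by move=> s; exact: sgd_in.
  exact: (g_subgradient (Wz omega)).
have mz : vector_measurable z.
  move=> i; rewrite (_ : (fun _ => _) =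
      fun omega => T%:R^-1 * \sum_(t <= s < t + T) w s omega ord0 i); last first.
    by apply/funext => omega; rewrite /z /window_average mxE summxE.
  apply: measurable_funM => //; apply: measurable_sum => s.
  exact: vector_measurable_sgd.
have bS : bounded_rv (fun omega =>
    T%:R^-1 * \sum_(t <= s < t + T) (F (w s omega) - Fmin)).
  by apply/bounded_rvZ/bounded_rv_sum => s; exact: bounded_excess.
have bFz : bounded_rv (fun omega => F (z omega) - Fmin).
  split.
    apply: measurable_funB => //.
    exact: within_continuous_measurable F_continuous mz Wz.
  have [_ [M hM]] := bS; exists M => omega.
  rewrite ger0_norm ?subr_ge0 ?Fmin_le//.
  by rewrite (le_trans (z_le _))// (le_trans (ler_norm _)).
have bFz' : bounded_rv (F \o z).
  rewrite (_ : F \o z = fun omega => (F (z omega) - Fmin) + Fmin).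
    by apply: bounded_rvD => //; exact: bounded_rv_cst.
  by apply/funext => omega /=; rewrite subrK.
have -> : ('E_P[F \o z] = (\int[P]_omega F (z omega))%:E)%E.
  rewrite unlock /Rintegral fineK//.
  exact/integrable_fin_num/bounded_rv_integrable.
rewrite -EFinB lee_fin -[X in _ - X](mean_cst P) -meanB//; last first.
  exact: bounded_rv_cst.
apply: le_trans (ler_mean P bFz bS z_le) _.
rewrite meanZ; last by apply: bounded_rv_sum => s; exact: bounded_excess.
rewrite mean_sum; last exact: bounded_excess.
have := mean_excess_window t T.
set S := \sum_(_ <= s < _) _; set E := Rintegral _ _ _.
move=> h; rewrite mulrC ler_pdivrMr//.
have -> : (alpha * G ^+ 2 / 2 + E / (2 * alpha * T%:R)) * T%:R =
   (E + T%:R * (alpha ^+ 2 * G ^+ 2)) / (2 * alpha).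
  by field; rewrite !gt_eqF.
by rewrite ler_pdivlMr ?mulr_gt0// mulrC.
Qed.

(** * Mean potential and the second moment of the distance *)

Section exponential_potential.
Hypothesis LG : L <= G.
Local Notation r := (r_P L G).
Local Notation rho := (rho_P L G).
Local Notation K := ((expR (2 * G * r) - rho) * expR (r * B_P L G)).
Local Notation potential t omega := (expR (r * dist t omega / alpha)).

Let r_gt0 : 0 < r. Proof. exact: r_P_gt0. Qed.

Lemma bounded_potential t : bounded_rv (fun omega => potential t omega).
Proof.
have [md _] := bounded_dist t; have [M hM] := dist_bounded t; split.
  apply: measurableT_comp => //; apply: measurable_funM => //.
  exact: measurable_funM.
exists (expR (r * M / alpha)) => omega; rewrite ger0_norm ?expR_ge0// ler_expR.
by rewrite ler_wpM2r ?invr_ge0 ?(ltW alpha_gt0)// ler_wpM2l ?(ltW r_gt0).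
Qed.

(** The weighted term of [exponential_drift] has nonnegative mean: there the noise
averages to the subgradient, and [F] grows at rate at least [L]. *)
Lemma mean_potential_step t :
  \int[P]_omega potential t.+1 omega <= rho * \int[P]_omega potential t omega + K.
Proof.
pose h := drift_weight L G alpha.
have mh : measurable_fun setT h by exact: measurable_drift_weight.
have h0 x : 0 <= h x by exact: drift_weight_ge0.
have [M hM] := dist_bounded t; have [md _] := bounded_dist t.
have [C hC] : exists C, forall omega, `|h (dist t omega)| <= C.
  exists (expR (r * M / alpha) * (r + r ^+ 2 * L) / (alpha * B_P L G)) => omega.
  by rewrite ger0_norm// drift_weight_le.
have bh : bounded_rv (fun omega => h (dist t omega)).
  by split; [exact: measurableT_comp|exists C].
have bp := bounded_potential.
have bhn := bounded_rvM bh (bounded_gap_noisy t).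
have bhg := bounded_rvM bh (bounded_gap_subgradient t).
have bhd := bounded_rvM bh (bounded_rvZ L (bounded_dist t)).
have drift omega : potential t.+1 omega + (h (dist t omega) *
    dotp (gap (w t omega)) (noisy t omega) - h (dist t omega) * (L * dist t omega))
    <= rho * potential t omega + K.
  rewrite -mulrBr; apply: exponential_drift => //.
  - exact: enorm_ge0.
  - exact: enorm_ge0.
  - exact: gap_noisy_le.
  - exact: dist_step.
have := ler_mean P (bounded_rvD (bp t.+1) (bounded_rvB bhn bhd))
  (bounded_rvD (bounded_rvZ rho (bp t)) (bounded_rv_cst K)) drift.
rewrite (meanD P (bp _) (bounded_rvB bhn bhd)) (meanB P bhn bhd).
rewrite (meanD P (bounded_rvZ rho (bp t)) (bounded_rv_cst K)) mean_cst.
rewrite (meanZ P _ (bp t)).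
apply: le_trans; rewrite lerDl subr_ge0.
have -> := mean_weighted_gap mh (ex_intro _ C hC).
apply: ler_mean => // omega; rewrite ler_wpM2l//.
apply: le_trans (F_polyhedral (sgd_in t omega)) _.
exact/gap_subgradient_ge/sgd_in.
Qed.

Lemma mean_potential_le t : \int[P]_omega potential t omega <=
  rho ^+ t * expR (r * enorm (gap w0) / alpha) + K / (1 - rho).
Proof.
elim: t => [|t IHt].
  rewrite [leLHS](mean_cst P (expR (r * enorm (gap w0) / alpha))) expr0 mul1r.
  rewrite lerDl divr_ge0 ?drift_const_ge0//.
  by rewrite subr_ge0 ltW// rho_P_lt1.
apply: le_trans (mean_potential_step t) _.
have rho1 : 1 - rho != 0 by rewrite subr_eq0 eq_sym lt_eqF// rho_P_lt1.
rewrite [leRHS](_ : _ = rho *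
    (rho ^+ t * expR (r * enorm (gap w0) / alpha) + K / (1 - rho)) + K).
  by rewrite lerD2r ler_wpM2l// ltW// rho_P_gt0.
by rewrite exprS; field.
Qed.

(** Since x^2 / 2 <= exp x for x = r dist / alpha, the second moment is at most
2 (alpha / r)^2 times the mean potential, which is at most 1 + D_P after the
transient. *)
Lemma mean_sqr_dist_le t : T_P L G alpha (enorm (gap w0)) <= t%:Z ->
  \int[P]_omega (dist t omega ^+ 2) <= alpha ^+ 2 * U_P L G.
Proof.
move=> tT; have c0 : 0 <= 2 * (alpha / r) ^+ 2 by rewrite mulr_ge0 ?sqr_ge0.
have bp := bounded_potential t.
apply: (@le_trans _ _ (\int[P]_omega (2 * (alpha / r) ^+ 2 * potential t omega))).
  apply: ler_mean; last 1 first.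
  - move=> omega; set x := r * _ / _.
    have -> : dist t omega ^+ 2 = 2 * (alpha / r) ^+ 2 * (x ^+ 2 / 2).
      by rewrite /x; field; rewrite !gt_eqF.
    rewrite ler_wpM2l// sqr_half_le_expR//.
    apply: divr_ge0; last exact: ltW.
    by apply: mulr_ge0; [exact: ltW r_gt0|exact: enorm_ge0].
  - by under eq_fun do rewrite expr2; apply: bounded_rvM; exact: bounded_dist.
  - exact: bounded_rvZ.
rewrite meanZ//.
have -> : alpha ^+ 2 * U_P L G = 2 * (alpha / r) ^+ 2 * (1 + D_P L G).
  by rewrite /U_P; field; rewrite gt_eqF.
rewrite ler_wpM2l// (le_trans (mean_potential_le t))// lerD2r.
exact: transient_le1.
Qed.

End exponential_potential.

End stochastic_subgradient.

Theorem theorem1 (R : realType) (N : nat) (W : set 'rV[R]_N)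
    (F : 'rV[R]_N -> R) (g : 'rV[R]_N -> 'rV[R]_N)
    (d : measure_display) (Omega : measurableType d) (P : probability Omega R)
    (ghat : nat -> 'rV[R]_N -> Omega -> 'rV[R]_N)
    (w0 : 'rV[R]_N) (alpha G L : R)
    (W_closed : closed W) (W_convex : convex_set W)
    (F_continuous : {within W, continuous F}) (F_convex : convex_function W F)
    (g_subgradient : forall w, W w -> subgradient W F w (g w))
    (w0_in : W w0) (alpha_gt0 : 0 < alpha)
    (ghat_unbiased : forall t w, W w -> cond_mean_eq P (ghat t w) (cst w) g)
    (ghat_unbiased_iterates : forall t,
       let w_t := sgd W alpha ghat w0 t in
       cond_mean_eq P (fun omega => ghat t (w_t omega) omega) w_t g)
    (min_attained : exists2 w, W w & forall w', W w' -> F w <= F w')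
    (minimizers_closed : closed (minimizers W F))
    (ghat_bounded : forall t w omega, W w -> enorm (ghat t w omega) <= G)
    (L_gt0 : 0 < L) (F_polyhedral : locally_polyhedral W F L)
    (t T : nat)
    (t_ge :
       T_P L G alpha (enorm (w0 - euclidean_proj (minimizers W F) w0)) <= t%:Z)
    (T_gt0 : (0 < T)%N) :
  ('E_P[F \o window_average (sgd W alpha ghat w0) t T] - (min_value W F)%:E
     <= (alpha * G ^+ 2 / 2 + alpha * U_P L G / (2 * T%:R))%:E)%E.
Proof.
have TR : 0 < T%:R :> R by rewrite ltr0n.
have [[x [Wx nAx]]|allA] := pselect (exists x, W x /\ ~ minimizers W F x).
  have LG : L <= G.
    exact: (lipschitz_ge_polyhedral g_subgradient ghat_unbiased min_attained
      minimizers_closed ghat_bounded F_polyhedral Wx nAx).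
  apply: le_trans (mean_average_excess W_closed W_convex F_continuous
    g_subgradient w0_in alpha_gt0 ghat_unbiased ghat_unbiased_iterates
    min_attained minimizers_closed ghat_bounded t T_gt0) _.
  rewrite lee_fin lerD2l ler_pdivrMr ?mulr_gt0//.
  have -> : alpha * U_P L G / (2 * T%:R) * (2 * alpha * T%:R) =
      alpha ^+ 2 * U_P L G by field; rewrite gt_eqF.
  exact: (mean_sqr_dist_le W_closed W_convex g_subgradient w0_in alpha_gt0
    ghat_unbiased ghat_unbiased_iterates min_attained minimizers_closed
    ghat_bounded L_gt0 F_polyhedral LG t_ge).
(* Every point of W is a minimizer: the average has no excess at all. *)
have F_const y : W y -> F y = min_value W F.
  move=> Wy; have [[]|nAy] := pselect (minimizers W F y) => //.
  by case: allA; exists y.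
have G_ge0 : 0 <= G.
  exact: le_trans (enorm_ge0 _) (ghat_bounded 0%N _ point w0_in).
rewrite (_ : F \o window_average _ t T = cst (min_value W F)); last first.
  apply/funext => omega /=; apply: F_const; apply: convex_set_average => // s.
  exact: sgd_in.
rewrite expectation_cst -EFinB subrr lee_fin addr_ge0//.
  by rewrite divr_ge0// mulr_ge0 ?sqr_ge0// ltW.
apply: divr_ge0; last by rewrite mulr_ge0// ltW.
by apply: mulr_ge0; [exact: ltW|exact: U_P_ge0].
Qed.
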